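(* Let $(M,g)$ be an oriented Riemannian 4-manifold that is $*_L$-Einstein with respect to a unit length vector field $T$. At each $p\in M$, the complex-linear curvature operator $\hat R_g\colon\Lambda^2_{\mathbb C}\to\Lambda^2_{\mathbb C}$ is similar to one of $$\underbrace{\begin{bmatrix}\lambda_1&0&0\\0&\lambda_2&0\\0&0&\lambda_3\end{bmatrix}}_{\text{Type I}},\qquad \underbrace{\begin{bmatrix}\lambda_1&0&0\\0&\lambda_2&1\\0&0&\lambda_2\end{bmatrix}}_{\text{Type II}},\qquad \underbrace{\begin{bmatrix}\lambda_1&1&0\\0&\lambda_1&1\\0&0&\lambda_1\end{bmatrix}}_{\text{Type III}},$$ according to the Petrov Type of $g$ at $p$, with $\lambda_1,\lambda_2,\lambda_3\in\mathbb C$ not necessarily distinct.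
   Context: Write $T^\flat := g(T,\cdot)$, $g_L:=g-2T^\flat\otimes T^\flat$ (a Lorentzian metric) and $\Lambda^2 := \Lambda^2(T_pM)$. For a metric $m$ of any signature, $\Lambda^2$ carries the inner product $\langle v_1\wedge w_1, v_2\wedge w_2\rangle_m := m(v_1,v_2)m(w_1,w_2) - m(v_1,w_2)m(w_1,v_2)$, and the Hodge star $*_m\colon\Lambda^2\to\Lambda^2$ is defined by $\xi\wedge *_m\eta = \langle\xi,\eta\rangle_m\, dV$, where $dV = e_1\wedge e_2\wedge e_3\wedge e_4$ for any oriented $m$-orthonormal basis. Here $*_L$ is the Hodge star of $g_L$; it satisfies $*_L^2=-1$. Curvature convention: $R(a,b,c,d) := g(\nabla_a\nabla_b c-\nabla_b\nabla_a c-\nabla_{[a,b]}c,d)$; the curvature operator $\hat R_g\colon\Lambda^2\to\Lambda^2$ of $g$ is defined by $\langle\hat R_g(v\wedge w),x\wedge y\rangle_g = -R(v,w,x,y)$. $(M,g)$ is $*_L$-Einstein (with respect to the unit length vector field $T$) if $\hat R_g\circ *_L=*_L\circ\hat R_g$. $\Lambda^2_{\mathbb C}$ denotes the real 6-dimensional space $\Lambda^2$ regarded as a 3-dimensional complex vector space via $i\xi:=*_L\xi$. When $g$ is $*_L$-Einstein, $\hat R_g$ is complex-linear on $\Lambda^2_{\mathbb C}$, and $g$ is said to have Petrov Type I, II, or III at $p$ if $\hat R_g\colon\Lambda^2_{\mathbb C}\to\Lambda^2_{\mathbb C}$ has, respectively, 3, 2, or 1 linearly independent complex eigenvectors at $p$.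 *)

(* Defs.v *)
From HB Require Import structures.
From mathcomp Require Import all_boot all_order all_algebra perm.
From mathcomp Require Import all_classical all_reals all_analysis.
From mathcomp Require Import complex ring.
Set Implicit Arguments.
Unset Strict Implicit.
Unset Printing Implicit Defensive.
Import Order.TTheory GRing.Theory Num.Theory.
Import numFieldNormedType.Exports.
Local Open Scope classical_set_scope.
Local Open Scope ring_scope.

Section Smooth.
Context {R : realType} {m : nat} {V : normedModType R}.
Local Notation E := 'rV[R]_m.+1.

(* [iter_deriv [:: v1; ...; vk] f] is the iterated directional derivative
   D_v1 (... (D_vk f)). *)
Definition iter_deriv (s : seq E) (f : E -> V) : E -> V :=
  foldr (fun v h => fun x => 'D_v h x) f s.

(* C^infinity on the open set U: all iterated directional derivatives exist and
   are (Frechet) differentiable, hence continuous, at each point of U. *)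
Definition smooth_on (U : set E) (f : E -> V) : Prop :=
  forall (s : seq E) (x : E), U x -> differentiable (iter_deriv s f) x.
End Smooth.

(* An oriented smooth 4-manifold without boundary, given by an oriented atlas:
   all transition maps have positive Jacobian determinant, and the orientation
   is the one for which every chart of the atlas is positively oriented. *)
Record oriented_manifold4 (R : realType) (M : topologicalType) := OrientedManifold4 {
  chart_index : Type;
  dom : chart_index -> set M;
  phi : chart_index -> M -> 'rV[R]_4;
  psi : chart_index -> 'rV[R]_4 -> M;
  cod : chart_index -> set 'rV[R]_4 := fun i => phi i @` dom i;
  trans : chart_index -> chart_index -> 'rV[R]_4 -> 'rV[R]_4 :=
    fun i j => phi j \o psi i;
  overlap : chart_index -> chart_index -> set 'rV[R]_4 :=
    fun i j => phi i @` (dom i `&` dom j);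
  manifold_hausdorff : hausdorff_space M;
  manifold_second_countable : @second_countable M;
  dom_open : forall i, open (dom i);
  dom_cover : forall p, exists i, dom i p;
  cod_open : forall i, open (cod i);
  phiK : forall i p, dom i p -> psi i (phi i p) = p;
  phi_continuous : forall i, {within dom i, continuous (phi i)};
  psi_continuous : forall i, {within cod i, continuous (psi i)};
  trans_smooth : forall i j, smooth_on (overlap i j) (trans i j);
  trans_oriented : forall i j x, overlap i j x -> 0 < \det (jacobian (trans i j) x)
}.

Section BilinearForms.
Context {R : realType} {n : nat}.

(* The bilinear form with Gram matrix m; vectors are rows. *)
Definition bform (m : 'M[R]_n) (v w : 'rV[R]_n) : R := (v *m m *m w^T) 0 0.

End BilinearForms.

Section Tensors.
Context {R : realType} {M : topologicalType} (A : oriented_manifold4 R M).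

(* Vector fields and metrics are given by their components in each chart.
   [jacobian f x] acts on row vectors: v *m jacobian f x = 'd f x v. *)
Record vector_field := VectorField {
  vf_comp : chart_index A -> 'rV[R]_4 -> 'rV[R]_4;
  vf_smooth : forall i, smooth_on (cod i) (vf_comp i);
  vf_compat : forall i j x, overlap i j x ->
    vf_comp j (trans i j x) = vf_comp i x *m jacobian (trans i j) x
}.

Record riemannian_metric := RiemannianMetric {
  metric : chart_index A -> 'rV[R]_4 -> 'M[R]_4;
  metric_smooth : forall i, smooth_on (cod i) (metric i);
  metric_sym : forall i x, cod i x -> (metric i x)^T = metric i x;
  metric_pos : forall i x, cod i x ->
    forall v, v != 0 -> 0 < bform (metric i x) v v;
  metric_compat : forall i j x, overlap i j x -> forall v w,
    bform (metric i x) v w =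
    bform (metric j (trans i j x))
      (v *m jacobian (trans i j) x) (w *m jacobian (trans i j) x)
}.

Definition unit_length (g : riemannian_metric) (T : vector_field) : Prop :=
  forall i x, cod i x -> bform (metric g i x) (vf_comp T i x) (vf_comp T i x) = 1.

End Tensors.

Section Curvature.
Context {R : realType}.
Local Notation E := 'rV[R]_4.
(* A metric and vector fields on an open subset of R^4. *)
Implicit Types (g : E -> 'M[R]_4) (X Y Z W : E -> E) (x : E).

Definition partial (k : 'I_4) g x : 'M[R]_4 := 'D_(delta_mx 0 k) g x.

(* Gamma_ij^k *)
Definition christoffel g x (i j k : 'I_4) : R :=
  2^-1 * \sum_l invmx (g x) k l *
    (partial i g x j l + partial j g x i l - partial l g x i j).

(* The Levi-Civita connection. *)
Definition nabla g X Y : E -> E := fun x =>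
  'D_(X x) Y x +
  \row_k \sum_i \sum_j X x 0 i * Y x 0 j * christoffel g x i j k.

Definition lie_bracket X Y : E -> E := fun x => 'D_(X x) Y x - 'D_(Y x) X x.

Definition curv_field g X Y Z W x : R :=
  bform (g x)
    (nabla g X (nabla g Y Z) x - nabla g Y (nabla g X Z) x
     - nabla g (lie_bracket X Y) Z x)
    (W x).

(* The value at x of the curvature tensor on tangent vectors; it does not depend
   on the vector fields extending them, so take those with constant components. *)
Definition curv g x (a b c d : E) : R :=
  curv_field g (cst a) (cst b) (cst c) (cst d) x.

End Curvature.

Section Bivectors.
Context {R : realType}.
Local Notation E := 'rV[R]_4.

(* Lambda^2 of R^4 as the space of antisymmetric contravariant 2-tensors. *)
Definition asym4 : {vspace 'M[R]_4} := lker (\1 + linfun trmx)%VF.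
Definition Lambda2 := subvs_of asym4.

Definition wedge (v w : E) : Lambda2 := vsproj asym4 (v^T *m w - w^T *m v).

(* The wedge product Lambda^2 x Lambda^2 -> Lambda^4, where Lambda^4 is
   identified with R by means of the coordinate 4-vector. *)
Definition wedge22 (xi eta : Lambda2) : R :=
  4^-1 * \sum_(s : 'S_4) (-1) ^+ s *
    (vsval xi (s 0) (s 1) * vsval eta (s 2) (s 3)).

(* The inner product induced on Lambda^2 by m: half the full contraction. *)
Definition inner2 (m : 'M[R]_4) (xi eta : Lambda2) : R :=
  2^-1 * \sum_i \sum_j \sum_k \sum_l
    m i k * m j l * (vsval xi i j * vsval eta k l).

Lemma wedgeE v w : vsval (wedge v w) = v^T *m w - w^T *m v.
Proof.
rewrite /wedge vsprojK // memv_ker add_lfunE id_lfunE lfunE /=.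
by rewrite linearB /= !trmx_mul !trmxK addrC subrKA subrr.
Qed.

Let wedge_coef (v w : E) i j : vsval (wedge v w) i j = v 0 i * w 0 j - w 0 i * v 0 j.
Proof. by rewrite wedgeE !mxE !big_ord1 !mxE. Qed.

Let bformM (m : 'M[R]_4) (v1 w1 v2 w2 : E) :
  \sum_i \sum_j \sum_k \sum_l
    m i k * m j l * (v1 0 i * w1 0 j * (v2 0 k * w2 0 l)) =
  bform m v1 v2 * bform m w1 w2.
Proof.
have bE v w : bform m v w = \sum_i \sum_k v 0 i * m i k * w 0 k.
  rewrite /bform mxE exchange_big /=; apply: eq_bigr => k _.
  by rewrite !mxE mulr_suml; apply: eq_bigr.
rewrite !bE mulr_suml; apply: eq_bigr => i _.
rewrite mulr_sumr; apply: eq_bigr => j _.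
rewrite mulr_suml; apply: eq_bigr => k _.
by rewrite mulr_sumr; apply: eq_bigr => l _; ring.
Qed.

Lemma inner2_wedge (m : 'M[R]_4) v1 w1 v2 w2 :
  inner2 m (wedge v1 w1) (wedge v2 w2) =
  bform m v1 v2 * bform m w1 w2 - bform m v1 w2 * bform m w1 v2.
Proof.
apply: (@mulfI _ 2); first by rewrite pnatr_eq0.
rewrite /inner2 mulrA divff ?mul1r ?pnatr_eq0 //.
have -> : 2 * (bform m v1 v2 * bform m w1 w2 - bform m v1 w2 * bform m w1 v2) =
  bform m v1 v2 * bform m w1 w2 - bform m v1 w2 * bform m w1 v2
  - bform m w1 v2 * bform m v1 w2 + bform m w1 w2 * bform m v1 v2 by ring.
rewrite -!bformM. rewrite -!sumrB -!big_split /=; apply: eq_bigr => i _.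
rewrite -!sumrB -!big_split /=; apply: eq_bigr => j _.
rewrite -!sumrB -!big_split /=; apply: eq_bigr => k _.
rewrite -!sumrB -!big_split /=; apply: eq_bigr => l _.
by rewrite !wedge_coef; ring.
Qed.

Lemma wedge22_wedge v1 w1 v2 w2 :
  wedge22 (wedge v1 w1) (wedge v2 w2) =
  \det (\matrix_(i < 4) nth 0 [:: v1; w1; v2; w2] i).
Proof.
pose D (a b c d : E) : 'M[R]_4 := \matrix_(i < 4) nth 0 [:: a; b; c; d] i.
have DE a b c d : \det (D a b c d) = \sum_(s : 'S_4) (-1) ^+ s *
    (a 0 (s 0) * b 0 (s 1) * (c 0 (s 2) * d 0 (s 3))).
  apply: eq_bigr => s _; congr (_ * _).
  rewrite 4!big_ord_recl big_ord0 !mxE /= mulr1 !mulrA.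
  by do !congr (_ * _); congr (_ 0 (s _)); apply: val_inj.
have D01 a b c d : \det (D b a c d) = - \det (D a b c d).
  have -> : D b a c d = xrow 0 1 (D a b c d).
    apply/matrixP => i j; rewrite !mxE.
    by case: i => -[|[|[|[|//]]]] Hi; rewrite permE.
  by rewrite xrowE det_mulmx det_perm odd_tperm /= expr1 mulN1r.
have D23 a b c d : \det (D a b d c) = - \det (D a b c d).
  have -> : D a b d c = xrow 2 3 (D a b c d).
    apply/matrixP => i j; rewrite !mxE.
    by case: i => -[|[|[|[|//]]]] Hi; rewrite permE.
  by rewrite xrowE det_mulmx det_perm odd_tperm /= expr1 mulN1r.
apply: (@mulfI _ 4); first by rewrite pnatr_eq0.
rewrite /wedge22 mulrA divff ?mul1r ?pnatr_eq0 // -/(D v1 w1 v2 w2).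
have -> : 4 * \det (D v1 w1 v2 w2) = \det (D v1 w1 v2 w2) - \det (D w1 v1 v2 w2)
   - \det (D v1 w1 w2 v2) + \det (D w1 v1 w2 v2) by rewrite (D23 w1 v1) (D23 v1 w1) (D01 v1 w1); ring.
rewrite !DE. rewrite -!sumrB -!big_split /=; apply: eq_bigr => s _.
rewrite !wedge_coef; move: ((-1) ^+ s) (s 0) (s 1) (s 2) (s 3) => e i j k l.
ring.
Qed.
(* The rows of e form an m-orthonormal basis (m of any signature), positively
   oriented with respect to the coordinate basis. *)
Definition oriented_orthonormal (m e : 'M[R]_4) : Prop :=
  [/\ forall i j, i != j -> bform m (row i e) (row j e) = 0,
      forall i, `|bform m (row i e) (row i e)| = 1
    & 0 < \det e].

Definition is_hodge_star (m : 'M[R]_4) (S : 'End(Lambda2)) : Prop :=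
  forall e, oriented_orthonormal m e -> forall xi eta,
    wedge22 xi (S eta) = inner2 m xi eta *
      wedge22 (wedge (row 0 e) (row 1 e)) (wedge (row 2 e) (row 3 e)).

(* Existence and uniqueness hold for nondegenerate symmetric m. *)
Definition hodge (m : 'M[R]_4) : 'End(Lambda2) := xget 0 (is_hodge_star m).

Definition lorentz (g : 'M[R]_4) (T : E) : 'M[R]_4 :=
  let Tflat := T *m g in g - 2 *: (Tflat^T *m Tflat).

Definition is_curvature_operator (g : E -> 'M[R]_4) x (S : 'End(Lambda2)) : Prop :=
  forall v w y z,
    inner2 (g x) (S (wedge v w)) (wedge y z) = - curv g x v w y z.

(* Existence and uniqueness follow from the symmetries of the curvature tensor of
   a smooth Riemannian metric. *)
Definition curvature_operator (g : E -> 'M[R]_4) x : 'End(Lambda2) :=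
  xget 0 (is_curvature_operator g x).

End Bivectors.

Section ComplexStructure.
Context {R : realType} {V : vectType R}.
(* J is meant to satisfy J^2 = -1; V is then a complex vector space, with
   i xi := J xi. *)
Variable J : 'End(V).

Definition cscale (z : R[i]) (xi : V) : V := complex.Re z *: xi + complex.Im z *: J xi.

Definition clin_indep k (xi : 'I_k -> V) : Prop :=
  forall c : 'I_k -> R[i], \sum_i cscale (c i) (xi i) = 0 -> forall i, c i = 0.

Definition cspanning k (xi : 'I_k -> V) : Prop :=
  forall eta, exists c : 'I_k -> R[i], eta = \sum_i cscale (c i) (xi i).

Definition has_indep_eigenvectors (S : 'End(V)) k : Prop :=
  exists xi : 'I_k -> V, clin_indep xi /\
    forall i, exists z : R[i], S (xi i) = cscale z (xi i).

(* The maximal number of linearly independent complex eigenvectors is k. *)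
Definition num_eigenvectors (S : 'End(V)) k : Prop :=
  has_indep_eigenvectors S k /\ ~ has_indep_eigenvectors S k.+1.

(* B is the matrix of S in some complex basis of V. *)
Definition csimilar (S : 'End(V)) k (B : 'M[R[i]]_k) : Prop :=
  exists xi : 'I_k -> V, [/\ clin_indep xi, cspanning xi &
    forall j, S (xi j) = \sum_i cscale (B i j) (xi i)].

End ComplexStructure.

Section Petrov.
Context {R : realType}.
Local Notation C := R[i].

Definition mx3 (s : seq (seq C)) : 'M[C]_3 :=
  \matrix_(i < 3, j < 3) nth 0 (nth [::] s i) j.

Definition formI (l1 l2 l3 : C) := mx3
  [:: [:: l1; 0;  0 ];
      [:: 0;  l2; 0 ];
      [:: 0;  0;  l3]].
Definition formII (l1 l2 : C) := mx3
  [:: [:: l1; 0;  0 ];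
      [:: 0;  l2; 1 ];
      [:: 0;  0;  l2]].
Definition formIII (l1 : C) := mx3
  [:: [:: l1; 1;  0 ];
      [:: 0;  l1; 1 ];
      [:: 0;  0;  l1]].

Context {M : topologicalType} {A : oriented_manifold4 R M}.
Variables (g : riemannian_metric A) (T : vector_field A).

(* Below, p is a point in the domain of the chart i, which identifies T_pM with
   R^4; none of the notions depends on the choice of i. *)
Definition starL (i : chart_index A) (p : M) : 'End(@Lambda2 R) :=
  hodge (lorentz (metric g i (phi i p)) (vf_comp T i (phi i p))).

Definition Rhat (i : chart_index A) (p : M) : 'End(@Lambda2 R) :=
  curvature_operator (metric g i) (phi i p).

Definition starL_einstein : Prop :=
  forall i p, dom i p -> (Rhat i p \o starL i p = starL i p \o Rhat i p)%VF.

Definition petrovI i p := num_eigenvectors (starL i p) (Rhat i p) 3.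
Definition petrovII i p := num_eigenvectors (starL i p) (Rhat i p) 2.
Definition petrovIII i p := num_eigenvectors (starL i p) (Rhat i p) 1.

End Petrov.

(* Main.v *)
Require Import Defs.
From HB Require Import structures.
From mathcomp Require Import all_boot all_order all_algebra perm.
From mathcomp Require Import all_classical all_reals all_analysis.
From mathcomp Require Import complex ring.
Import Order.TTheory GRing.Theory Num.Theory.
Import numFieldNormedType.Exports.
Set Implicit Arguments.
Unset Strict Implicit.
Unset Printing Implicit Defensive.
Local Open Scope classical_set_scope.
Local Open Scope ring_scope.

(** The theorem is pointwise linear algebra. Fix p and a chart, and write J for
the Hodge star of g_L and S for the curvature operator at p. Two facts about J
matter: J^2 = -1 and, by the Einstein hypothesis, S commutes with J.

That J^2 = -1 ([starL_sqr]) combines two ingredients. First, Gram-Schmidt and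
the unit vector T give a positively oriented frame in which g_L is
diag(-1,1,1,1) ([lorentz_frame]), so det g_L < 0. Second, let D be the Euclidean
star of the coordinate basis ([coord_star]) and Lambda^2 m the map induced by a
symmetric matrix m ([push]). Then wedge22 xi (D eta) is the Euclidean product of
xi and eta, and that product with eta replaced by (Lambda^2 m) eta is the product
of m. So the Hodge star of m is a multiple of D o Lambda^2 m, which proves that
it exists ([hodgeP]); and since Lambda^2 m multiplies the pairing wedge22 by
det m, the square of the star is the sign of det m ([hodge_sqr]).

As J^2 = -1 and Lambda^2 has real dimension 6, it has a complex basis of three
bivectors ([complex_basis]), in which S becomes a complex 3 x 3 matrix B. With
bivectors as coordinate rows, c |-> c *m B, independent eigenvectors are the rows
of a row-free X with X *m B = diag_mx d *m X ([eigenrows]). The three normal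
forms are then found from the number of independent eigenvectors:
- with three of them, B is diagonal in the basis they form;
- with two but not three, complete them by any third vector. B sends it to a
  multiple of itself plus a combination of the eigenvectors; after a correction
  that removes as much of this combination as possible, what is left must be a
  nonzero eigenvector of the same eigenvalue, as otherwise there would be a third
  eigenvector. This is a Jordan block of size 2 ([eigenrows2_formII]);
- without two, triangularise B. Distinct diagonal entries or a zero just below
  the diagonal would produce a second eigenvector, so B minus its eigenvalue is
  nilpotent of order exactly 3 ([not_eigenrows2_formIII]).
There is always one eigenvector, and there are never four, so exactly these
cases occur ([complex_jordan3]). *)

(** * Bivectors in coordinates *)

Lemma det3E (K : comNzRingType) (B : 'M[K]_3) :
  \det B = B 0 0 * (B 1 1 * B 2 2 - B 1 2 * B 2 1)
         - B 0 1 * (B 1 0 * B 2 2 - B 1 2 * B 2 0)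
         + B 0 2 * (B 1 0 * B 2 1 - B 1 1 * B 2 0).
Proof.
pose b i j := B (inord i) (inord j).
have bE i j : B i j = b i j by rewrite /b !inord_val.
rewrite (expand_det_row _ 0) !big_ord_recl big_ord0 /cofactor.
rewrite !(expand_det_row _ 0) !big_ord_recl !big_ord0 /cofactor !det_mx11 !mxE.
by rewrite !bE /= /bump /=; ring.
Qed.

(** Laplace expansion along the first two rows: p and q are the Pluecker
coordinates of the planes spanned by the first two and the last two rows. *)
Lemma det4E (K : comNzRingType) (B : 'M[K]_4)
    (p := fun i j => B 0 i * B 1 j - B 0 j * B 1 i)
    (q := fun i j => B 2 i * B 3 j - B 2 j * B 3 i) :
  \det B = p 0 1 * q 2 3 - p 0 2 * q 1 3 + p 0 3 * q 1 2
         + p 1 2 * q 0 3 - p 1 3 * q 0 2 + p 2 3 * q 0 1.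
Proof.
pose b i j := B (inord i) (inord j).
have bE i j : B i j = b i j by rewrite /b !inord_val.
rewrite (expand_det_row _ 0) !big_ord_recl big_ord0 /cofactor !det3E !mxE.
by rewrite /p /q !bE /= /bump /=; ring.
Qed.

Section Lambda2.
Context {R : realType}.
Local Notation E := 'rV[R]_4.
Local Notation L2 := (@Lambda2 R).
Implicit Types (xi eta : L2) (v w : E) (m A : 'M[R]_4).

Lemma Lambda2_asym xi : (vsval xi)^T = - vsval xi.
Proof.
have := subvsP xi; rewrite memv_ker add_lfunE id_lfunE lfunE /= addrC addr_eq0.
by move=> /eqP.
Qed.

Lemma vsval_asym xi i j : vsval xi j i = - vsval xi i j.
Proof. by have /matrixP/(_ i j) := Lambda2_asym xi; rewrite !mxE. Qed.

Lemma vsval_linear a xi eta : vsval (a *: xi + eta) = a *: vsval xi + vsval eta.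
Proof. exact: linearP. Qed.

Lemma vsval_diag xi i : vsval xi i i = 0.
Proof.
apply/eqP; have /eqP := vsval_asym xi i i.
by rewrite -addr_eq0 -mulr2n mulrn_eq0.
Qed.

Lemma vsval_vsproj A : A^T = - A -> vsval (vsproj asym4 A) = A.
Proof.
by move=> AT; rewrite vsprojK // memv_ker add_lfunE id_lfunE lfunE /= AT subrr.
Qed.

Lemma Lambda2P xi eta :
  (forall i j : 'I_4, (i < j)%N -> vsval xi i j = vsval eta i j) -> xi = eta.
Proof.
move=> xiE; apply/val_inj/matrixP => i j.
have [ij|ji|/val_inj ->] := ltngtP i j; first exact: xiE.
  by rewrite /= vsval_asym xiE // -vsval_asym.
by rewrite /= !vsval_diag.
Qed.

Definition asym_mx (a01 a02 a03 a12 a13 a23 : R) : 'M[R]_4 :=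
  \matrix_(i, j) nth 0 (nth [::]
   [:: [:: 0; a01; a02; a03]; [:: - a01; 0; a12; a13];
       [:: - a02; - a12; 0; a23]; [:: - a03; - a13; - a23; 0]] i) j.

Definition bivec a01 a02 a03 a12 a13 a23 : L2 :=
  vsproj asym4 (asym_mx a01 a02 a03 a12 a13 a23).

Lemma bivecE a01 a02 a03 a12 a13 a23 :
  vsval (bivec a01 a02 a03 a12 a13 a23) = asym_mx a01 a02 a03 a12 a13 a23.
Proof.
apply/vsval_vsproj/matrixP => i j; rewrite !mxE.
by case: i => -[|[|[|[|//]]]] Hi; case: j => -[|[|[|[|//]]]] Hj /=; rewrite ?opprK ?oppr0.
Qed.

Lemma bivec_coords xi : xi =
  bivec (vsval xi 0 1) (vsval xi 0 2) (vsval xi 0 3)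
        (vsval xi 1 2) (vsval xi 1 3) (vsval xi 2 3).
Proof.
apply: Lambda2P => i j; rewrite bivecE mxE.
by case: i => -[|[|[|[|//]]]] Hi; case: j => -[|[|[|[|//]]]] Hj //= _;
  congr (vsval xi _ _); apply: val_inj.
Qed.

Definition coords xi : 'rV[R]_6 :=
  \row_i nth 0 [:: vsval xi 0 1; vsval xi 0 2; vsval xi 0 3;
                   vsval xi 1 2; vsval xi 1 3; vsval xi 2 3] i.

Lemma coords_is_linear : linear coords.
Proof.
move=> a xi eta; apply/rowP => i; rewrite !mxE.
by case: i => -[|[|[|[|[|[|//]]]]]].
Qed.
HB.instance Definition _ := GRing.isLinear.Build R L2 'rV[R]_6 _ coords coords_is_linear.

(** This real dimension is what makes the complex dimension equal to 3. *)
Lemma dim_Lambda2 : \dim {:L2} = 6.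
Proof.
have <- : \dim (limg (linfun coords)) = 6.
  have -> : limg (linfun coords) = fullv.
    apply/eqP; rewrite eqEsubv subvf; apply/subvP => c _; apply/memv_imgP.
    exists (bivec (c 0 0) (c 0 1) (c 0 2) (c 0 3) (c 0 4) (c 0 5)); first exact: memvf.
    apply/rowP => i; rewrite lfunE /= !mxE bivecE !mxE.
    by case: i => -[|[|[|[|[|[|//]]]]]] Hi /=; congr (c _ _); apply: val_inj.
  by rewrite dimvf dim_matrix.
rewrite limg_dim_eq //; apply/eqP; rewrite capfv -subv0; apply/subvP => xi.
rewrite memv_ker memv0 lfunE /= => /eqP/rowP c0; rewrite (bivec_coords xi).
have := (c0 0, c0 1, c0 2, c0 3, c0 4, c0 5); rewrite !mxE /=.
move=> [[[[[-> ->] ->] ->] ->] ->]; apply/eqP/Lambda2P => i j _.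
rewrite bivecE linear0 !mxE.
by case: i => -[|[|[|[|//]]]] Hi; case: j => -[|[|[|[|//]]]] Hj /=; rewrite ?oppr0.
Qed.

(** Identities that are linear in a bivector need only be checked on simple
bivectors, where [wedge22_wedge] and [wedgeE] apply. *)
Lemma wedge_ind (P : L2 -> Prop) :
  (forall v w, P (wedge v w)) ->
  (forall a xi eta, P xi -> P eta -> P (a *: xi + eta)) -> forall xi, P xi.
Proof.
move=> Pw Plin xi.
pose e (i : 'I_4) : E := delta_mx 0 i.
have -> : xi = vsval xi 0 1 *: wedge (e 0) (e 1) + (vsval xi 0 2 *: wedge (e 0) (e 2)
  + (vsval xi 0 3 *: wedge (e 0) (e 3) + (vsval xi 1 2 *: wedge (e 1) (e 2)
  + (vsval xi 1 3 *: wedge (e 1) (e 3) + (vsval xi 2 3 *: wedge (e 2) (e 3) + wedge 0 0))))).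
  apply: Lambda2P => i j ij; rewrite {1}[xi]bivec_coords bivecE !vsval_linear.
  move: (vsval xi) => x; rewrite !wedgeE !mxE !big_ord1 !mxE.
  case: i ij => -[|[|[|[|//]]]] Hi; case: j => -[|[|[|[|//]]]] Hj //= _;
    by rewrite !(oppr0, mulr1, mulr0, mul0r, subr0, addr0, add0r).
by do 6 (apply: (Plin); first exact: Pw); exact: Pw.
Qed.

Lemma wedge22_linearl a xi1 xi2 eta :
  wedge22 (a *: xi1 + xi2) eta = a * wedge22 xi1 eta + wedge22 xi2 eta.
Proof.
rewrite /wedge22 vsval_linear mulrCA -mulrDr; congr (_ * _).
rewrite mulr_sumr -big_split; apply: eq_bigr => s _ /=.
by rewrite !mxE; move: ((-1) ^+ s) => e; ring.
Qed.

Lemma wedge22_linearr a xi eta1 eta2 :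
  wedge22 xi (a *: eta1 + eta2) = a * wedge22 xi eta1 + wedge22 xi eta2.
Proof.
rewrite /wedge22 vsval_linear mulrCA -mulrDr; congr (_ * _).
rewrite mulr_sumr -big_split; apply: eq_bigr => s _ /=.
by rewrite !mxE; move: ((-1) ^+ s) => e; ring.
Qed.

Lemma wedge22Zr a xi eta : wedge22 xi (a *: eta) = a * wedge22 xi eta.
Proof.
have /eqP := wedge22_linearr 1 xi 0 0.
rewrite scale1r add0r mul1r -subr_eq0 opprD addrA subrr sub0r oppr_eq0 => /eqP w0.
by rewrite -[a *: eta]addr0 wedge22_linearr w0 addr0.
Qed.

Lemma wedge22E xi eta : let x := vsval xi in let y := vsval eta in
  wedge22 xi eta = x 0 1 * y 2 3 - x 0 2 * y 1 3 + x 0 3 * y 1 2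
                 + x 1 2 * y 0 3 - x 1 3 * y 0 2 + x 2 3 * y 0 1.
Proof.
move=> x y; rewrite {}/x {}/y; elim/wedge_ind: xi => [v1 w1|a xi1 xi2 IH1 IH2]; last first.
  by rewrite wedge22_linearl IH1 IH2 vsval_linear !mxE; ring.
elim/wedge_ind: eta => [v2 w2|a eta1 eta2 IH1 IH2]; last first.
  by rewrite wedge22_linearr IH1 IH2 vsval_linear !mxE; ring.
rewrite wedge22_wedge det4E !wedgeE !mxE !big_ord1 !mxE /=; ring.
Qed.

Lemma wedge22C xi eta : wedge22 xi eta = wedge22 eta xi.
Proof. by rewrite !wedge22E /=; ring. Qed.

(** The map induced on bivectors by v |-> v *m A. *)
Definition push A xi : L2 := vsproj asym4 (A^T *m vsval xi *m A).

Lemma pushE A xi : vsval (push A xi) = A^T *m vsval xi *m A.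
Proof.
by apply: vsval_vsproj; rewrite !trmx_mul trmxK Lambda2_asym mulNmx mulmxN mulmxA.
Qed.

Lemma push_is_linear A : linear (push A).
Proof.
move=> a xi eta; apply: subvs_inj; rewrite vsval_linear !pushE vsval_linear.
by rewrite mulmxDr mulmxDl -scalemxAr -scalemxAl.
Qed.
HB.instance Definition _ A := GRing.isLinear.Build R L2 L2 _ (push A) (push_is_linear A).

Lemma push_wedge A v w : push A (wedge v w) = wedge (v *m A) (w *m A).
Proof.
by apply: subvs_inj; rewrite pushE !wedgeE !trmx_mul mulmxBr mulmxBl !mulmxA.
Qed.

(** The determinant is the action of A on 4-vectors. *)
Lemma wedge22_push A xi eta : wedge22 (push A xi) (push A eta) = \det A * wedge22 xi eta.
Proof.
elim/wedge_ind: xi => [v1 w1|a xi1 xi2 IH1 IH2]; last first.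
  by rewrite linearP /= !wedge22_linearl IH1 IH2; ring.
elim/wedge_ind: eta => [v2 w2|a eta1 eta2 IH1 IH2]; last first.
  by rewrite linearP /= !wedge22_linearr IH1 IH2; ring.
rewrite !push_wedge !wedge22_wedge mulrC -det_mulmx; congr (\det _).
apply/row_matrixP => i; rewrite row_mul !rowK.
by case: i => -[|[|[|[|//]]]].
Qed.

(** The Hodge star of the Euclidean metric for which the coordinate basis is
orthonormal; it turns [wedge22] into an inner product ([inner2_1]). *)
Definition coord_star xi : L2 := bivec (vsval xi 2 3) (- vsval xi 1 3) (vsval xi 1 2)
  (vsval xi 0 3) (- vsval xi 0 2) (vsval xi 0 1).

Lemma coord_star_is_linear : linear coord_star.
Proof.
move=> a xi eta; apply: Lambda2P => i j _; rewrite vsval_linear !bivecE !mxE.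
by case: i => -[|[|[|[|//]]]] Hi; case: j => -[|[|[|[|//]]]] Hj /=; ring.
Qed.
HB.instance Definition _ := GRing.isLinear.Build R L2 L2 _ coord_star coord_star_is_linear.

Lemma coord_starK xi : coord_star (coord_star xi) = xi.
Proof. by rewrite /coord_star !bivecE !mxE /= !opprK -bivec_coords. Qed.

Lemma inner2E m xi eta :
  inner2 m xi eta = 2^-1 * \tr ((vsval xi)^T *m (m *m vsval eta *m m^T)).
Proof.
congr (_ * _); rewrite /mxtrace exchange_big; apply: eq_bigr => j _ /=.
rewrite mxE; apply: eq_bigr => i _; rewrite !mxE mulr_sumr exchange_big.
apply: eq_bigr => l _ /=; rewrite mxE mulr_suml mulr_sumr; apply: eq_bigr => k _.
by rewrite mxE; ring.
Qed.

Lemma inner2_1 xi eta : inner2 1%:M xi eta = wedge22 xi (coord_star eta).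
Proof.
rewrite inner2E mul1mx trmx1 mulmx1 wedge22E /= bivecE !mxE /= /mxtrace.
rewrite !big_ord_recl big_ord0 !mxE !big_ord_recl !big_ord0 !mxE.
rewrite (bivec_coords xi) (bivec_coords eta) !bivecE !mxE /=.
by field.
Qed.

(** The product of m is the Euclidean one with an argument transported by m.
This makes [coord_star] composed with [push m] a Hodge star of m, up to scale. *)
Lemma inner2_push m xi eta : inner2 m xi eta = inner2 1%:M xi (push m^T eta).
Proof. by rewrite !inner2E pushE !trmxK trmx1 mul1mx mulmx1. Qed.

Lemma inner2C m xi eta : m^T = m -> inner2 m xi eta = inner2 m eta xi.
Proof.
move=> mT; rewrite !inner2E mT; congr (_ * _).
by rewrite -mxtrace_tr !trmx_mul trmxK mT -!mulmxA mxtrace_mulC !mulmxA.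
Qed.

(** The pairing of eta with its Euclidean star is a sum of squares. *)
Lemma wedge22_nondeg eta : (forall xi, wedge22 xi eta = 0) -> eta = 0.
Proof.
move=> eta0; pose z := coord_star eta.
have : wedge22 z eta = 0 by [].
rewrite -[eta]coord_starK -inner2_1 -/z inner2E !(mul1mx, trmx1, mulmx1) => /eqP.
rewrite mulf_eq0 invr_eq0 pnatr_eq0 /= => /eqP z0.
suff -> : z = 0 by rewrite linear0.
have sq_ge0 (i j : 'I_4) : 0 <= vsval z j i ^+ 2 by exact: sqr_ge0.
have /eqP : \sum_i \sum_j vsval z j i ^+ 2 = 0.
  by rewrite -[RHS]z0; apply: eq_bigr => i _; rewrite mxE; apply: eq_bigr => j _; rewrite mxE.
rewrite psumr_eq0 => [/allP zi|i _]; last exact: sumr_ge0.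
apply: Lambda2P => i j _; rewrite linear0 [RHS]mxE.
have /implyP/(_ isT) := zi j (mem_index_enum j).
rewrite psumr_eq0 // => /allP/(_ i (mem_index_enum i))/=.
by rewrite sqrf_eq0 => /eqP.
Qed.

End Lambda2.

(** * Orthonormal frames and the Hodge star *)

(** Induction on the dimension: the matrix L clears the first row and column of g
outside the diagonal, and the remaining Schur complement d' is again positive
definite. *)
Lemma posdef_orthonormal (R : realType) n (g : 'M[R]_n) : g^T = g ->
  (forall v : 'rV_n, v != 0 -> 0 < bform g v v) -> exists e : 'M[R]_n, e *m g *m e^T = 1%:M.
Proof.
elim: n g => [|n IHn] g gT g_gt0; first by exists 0; apply/matrixP => -[].
move: g gT g_gt0; rewrite -[n.+1]/(1 + n)%N => g gT g_gt0.
pose a := ulsubmx g 0 0; pose b := ursubmx g; pose d := drsubmx g.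
have gE : g = block_mx a%:M b b^T d.
  by rewrite /a /b /d trmx_ursub gT -mx11_scalar submxK.
have a_gt0 : 0 < a.
  have v_neq0 : row_mx 1%:M 0 != 0 :> 'rV[R]_(1 + n).
    apply/eqP => /(congr1 lsubmx); rewrite row_mxKl linear0 => /matrixP/(_ 0 0).
    by rewrite !mxE => /eqP; rewrite oner_eq0.
  have := g_gt0 _ v_neq0; rewrite /bform [X in _ *m X *m _]gE mul_row_block tr_row_mx.
  by rewrite mul_row_col !(mul1mx, mul0mx, trmx1, trmx0, mulmx0, mulmx1, addr0) !mxE mulr1n.
pose L : 'M[R]_(1 + n) := block_mx 1%:M 0 (- (a^-1 *: b^T)) 1%:M.
pose d' := d - a^-1 *: (b^T *m b).
have LT : L^T = block_mx 1%:M (- (a^-1 *: b)) 0 1%:M.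
  by rewrite tr_block_mx !trmx1 trmx0 linearN linearZ /= trmxK.
have LgL : L *m g *m L^T = block_mx a%:M 0 0 d'.
  rewrite {}LT /L {1}gE !mulmx_block !(mul1mx, mulmx1, mul0mx, mulmx0, addr0, add0r).
  rewrite mulNmx mul_mx_scalar scalerA divff ?gt_eqF // scale1r addNr mul0mx add0r.
  rewrite mulmxN mul_scalar_mx scalerA divff ?gt_eqF // scale1r addNr.
  by rewrite mulNmx -scalemxAl [- _ + d]addrC.
have [e' e'P] : exists e' : 'M[R]_n, e' *m d' *m e'^T = 1%:M.
  apply: IHn.
    by rewrite /d' linearB linearZ /= trmx_mul trmxK [d^T]trmx_drsub gT.
  move=> v vN0; pose w := row_mx 0 v *m L.
  have wN0 : w != 0.
    apply: contraNneq vN0 => /(congr1 rsubmx).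
    by rewrite linear0 /w mul_row_block row_mxKr mul0mx mulmx1 add0r => ->.
  have := g_gt0 _ wN0; rewrite /bform /w trmx_mul !mulmxA.
  rewrite -[_ *m L *m g]mulmxA -[_ *m L^T]mulmxA LgL tr_row_mx mul_row_block mul_row_col.
  by rewrite !(mul0mx, mulmx0, trmx0, add0r).
exists (block_mx (Num.sqrt a)^-1%:M 0 0 e' *m L).
rewrite trmx_mul !mulmxA -[_ *m L *m g]mulmxA -[_ *m L^T]mulmxA LgL.
rewrite tr_block_mx !mulmx_block !(mul0mx, mulmx0, trmx0, addr0, add0r) e'P.
rewrite tr_scalar_mx -!scalar_mxM mulrAC -expr2 exprVn sqr_sqrtr ?ltW // mulVf ?gt_eqF //.
by rewrite -scalar_mx_block.
Qed.

Section Frames.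
Context {R : realType}.
Local Notation E := 'rV[R]_4.
Local Notation L2 := (@Lambda2 R).
Implicit Types (xi eta : L2) (v w : E) (m A e : 'M[R]_4).

Lemma bform_row n (g : 'M[R]_n) (A : 'M[R]_n) i j : bform g (row i A) (row j A) = (A *m g *m A^T) i j.
Proof.
by rewrite /bform -row_mul mxE [RHS]mxE; apply: eq_bigr => k _; rewrite !mxE.
Qed.

(** In an orthonormal frame the Gram matrix of m is diagonal with entries 1 and
-1. *)
Lemma oriented_orthonormal_det m e : oriented_orthonormal m e ->
  `|\det m| * \det e ^+ 2 = 1.
Proof.
move=> [orth norm1 e_gt0].
have eme : e *m m *m e^T = diag_mx (\row_i bform m (row i e) (row i e)).
  apply/matrixP => i j; rewrite -bform_row !mxE.
  by have [->|/orth ->] := eqVneq i j; rewrite ?mulr1n ?mulr0n.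
have := congr1 (fun x => `|\det x|) eme.
rewrite !det_mulmx det_tr det_diag normr_prod big1 => [|i _]; last by rewrite mxE norm1.
by rewrite !normrM (gtr0_norm e_gt0) => <-; ring.
Qed.

(** The volume form does not depend on the frame; hence the condition defining a
Hodge star need only be checked in one frame ([is_hodge_starP]). *)
Lemma oriented_orthonormal_det_eq m e f :
  oriented_orthonormal m e -> oriented_orthonormal m f -> \det e = \det f.
Proof.
move=> oe of_; have := oriented_orthonormal_det of_.
have := oriented_orthonormal_det oe; case: oe => _ _ e0; case: of_ => _ _ f0.
move=> me mf; have mN0 : `|\det m| != 0.
  by apply/eqP => m0; move/eqP: me; rewrite m0 mul0r eq_sym oner_eq0.
by apply/eqP; rewrite -(eqrXn2 (n := 2)) ?ltW //; apply/eqP/(mulfI mN0); rewrite me mf.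
Qed.

Lemma is_hodge_starP m e S : oriented_orthonormal m e ->
  is_hodge_star m S <-> forall xi eta, wedge22 xi (S eta) = \det e * inner2 m xi eta.
Proof.
have vol (e' : 'M[R]_4) : wedge22 (wedge (row 0 e') (row 1 e')) (wedge (row 2 e') (row 3 e')) = \det e'.
  rewrite wedge22_wedge; congr (\det _); apply/row_matrixP => i; rewrite rowK.
  by case: i => -[|[|[|[|//]]]] Hi /=; congr (row _ _); apply: val_inj.
move=> oe; split=> [HS xi eta|HS f of_ xi eta]; first by rewrite (HS e oe) vol mulrC.
by rewrite HS vol mulrC (oriented_orthonormal_det_eq oe of_).
Qed.

(** The star is constructed explicitly, as a multiple of [coord_star \o push m]. *)
Lemma hodgeP m e : m^T = m -> oriented_orthonormal m e -> is_hodge_star m (hodge m).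
Proof.
move=> mT oe; apply: xgetPex.
exists (\det e *: linfun (coord_star \o push m))%VF.
apply/(is_hodge_starP _ oe) => xi eta.
by rewrite scale_lfunE lfunE /= wedge22Zr -inner2_1 [in RHS]inner2_push mT.
Qed.

(** By nondegeneracy of [wedge22] it is enough to pair J (J xi) with any eta. The
defining property of J is used twice: on the outer J, and on the inner one after
the product of m has been rewritten as a wedge pairing. This gives the factor
det m * (det e)^2, which is -1 because e is orthonormal and det m < 0. *)
Lemma hodge_sqr m e : m^T = m -> oriented_orthonormal m e -> \det m < 0 ->
  forall xi, hodge m (hodge m xi) = - xi.
Proof.
move=> mT oe m_lt0 xi; have /(is_hodge_starP _ oe) := hodgeP mT oe.
move: (hodge m) => J JP.
apply/eqP; rewrite -addr_eq0; apply/eqP/wedge22_nondeg => eta.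
rewrite -[J (J xi)]scale1r wedge22_linearr mul1r JP.
have -> : inner2 m eta (J xi) = \det e * \det m * wedge22 eta xi.
  rewrite inner2C // inner2_push mT inner2_1 wedge22C JP inner2_push mT.
  rewrite inner2C ?trmx1 // inner2_1 coord_starK wedge22_push.
  by rewrite [wedge22 xi _]wedge22C mulrA.
have := oriented_orthonormal_det oe; rewrite ltr0_norm // => em.
by rewrite -[X in _ + X]mul1r -em; ring.
Qed.

Definition minkowski : 'M[R]_4 := 1%:M - 2 *: delta_mx 0 0.

Lemma minkowskiE : minkowski = diag_mx (\row_i (-1) ^+ (i == 0)).
Proof.
apply/matrixP => i j; rewrite !mxE.
by case: i => -[|[|[|[|//]]]] Hi; case: j => -[|[|[|[|//]]]] Hj /=;
  rewrite ?(expr1, expr0, mulr0, mulr1, mulr1n, mulr0n, subr0) //; ring.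
Qed.

Lemma minkowski_frame m f : f *m m *m f^T = minkowski -> 0 < \det f ->
  oriented_orthonormal m f.
Proof.
move=> fmf f_gt0; split=> // [i j ij|i]; rewrite bform_row fmf minkowskiE !mxE.
  by rewrite (negPf ij) mulr0n.
by rewrite eqxx mulr1n normrX normrN1 expr1n.
Qed.

Lemma det_minkowski : \det minkowski = -1.
Proof.
rewrite minkowskiE det_diag !big_ord_recl big_ord0 !mxE /=.
by rewrite !(expr0, expr1, mulr1).
Qed.

(** The rows are the quaternions t, it, jt and kt, which are orthonormal when t is
a unit vector. *)
Definition quaternion_mx (t : E) : 'M[R]_4 := \matrix_(i, j) nth 0 (nth [::]
  [:: [:: t 0 0; t 0 1; t 0 2; t 0 3]; [:: - t 0 1; t 0 0; - t 0 3; t 0 2];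
      [:: - t 0 2; t 0 3; t 0 0; - t 0 1]; [:: - t 0 3; - t 0 2; t 0 1; t 0 0]] i) j.

Lemma quaternion_mx_orthogonal (t : E) : t *m t^T = 1%:M ->
  quaternion_mx t *m (quaternion_mx t)^T = 1%:M.
Proof.
move=> /matrixP/(_ 0 0); rewrite !mxE !big_ord_recl big_ord0 !mxE /= => t1.
apply/matrixP => i j; rewrite !mxE !big_ord_recl big_ord0 !mxE /=.
move: t1.
have -> : lift ord0 ord0 = 1 :> 'I_4 by apply: val_inj.
have -> : lift ord0 (lift ord0 ord0) = 2 :> 'I_4 by apply: val_inj.
have -> : lift ord0 (lift ord0 (lift ord0 ord0)) = 3 :> 'I_4 by apply: val_inj.
move: (t 0 0) (t 0 1) (t 0 2) (t 0 3) => t0 t1 t2 t3; rewrite ?mulr1n => t_unit.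
case: i => -[|[|[|[|//]]]] Hi; case: j => -[|[|[|[|//]]]] Hj /=;
  rewrite ?(mulr1n, mulr0n) -?t_unit; ring.
Qed.

Lemma row0_quaternion_mx (t : E) : row 0 (quaternion_mx t) = t.
Proof.
apply/rowP => j; rewrite !mxE.
by case: j => -[|[|[|[|//]]]] Hj /=; congr (t _ _); apply: val_inj.
Qed.

(** An arbitrary g-orthonormal frame e is rotated so that its first vector becomes
T; the rotation is found from the coordinates t of T in e. *)
Lemma orthonormal_frame_through (g : 'M[R]_4) (T : E) : g^T = g ->
  (forall v, v != 0 -> 0 < bform g v v) -> bform g T T = 1 ->
  exists f : 'M[R]_4, f *m g *m f^T = 1%:M /\ row 0 f = T.
Proof.
move=> gT g_gt0 T1.
have [e ege] := posdef_orthonormal gT g_gt0.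
have ue : e \in unitmx by have [] := mulmx1_unit (etrans (mulmxA _ _ _) ege).
pose t := T *m invmx e.
have Tt : T = t *m e by rewrite mulmxKV.
have t1 : t *m t^T = 1%:M.
  have : T *m g *m T^T = t *m t^T.
    by rewrite Tt trmx_mul !mulmxA -[t *m e *m g]mulmxA -[_ *m e^T]mulmxA ege mulmx1.
  by rewrite [LHS]mx11_scalar => <-; rewrite [_ 0 0]T1.
exists (quaternion_mx t *m e); split; last by rewrite row_mul row0_quaternion_mx.
rewrite trmx_mul !mulmxA -[_ *m e *m g]mulmxA -[_ *m e^T]mulmxA ege mulmx1.
exact: quaternion_mx_orthogonal.
Qed.

(** In a g-orthonormal frame that starts with T, g_L differs from g only in
changing the sign of T. A frame with the wrong orientation is corrected by
reflecting T, which preserves the Gram matrix. *)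
Lemma lorentz_frame (g : 'M[R]_4) (T : E) : g^T = g ->
  (forall v, v != 0 -> 0 < bform g v v) -> bform g T T = 1 ->
  exists f : 'M[R]_4, f *m lorentz g T *m f^T = minkowski /\ 0 < \det f.
Proof.
move=> gT g_gt0 T1.
have [f [fgf Tf]] := orthonormal_frame_through gT g_gt0 T1.
have fmf : f *m lorentz g T *m f^T = minkowski.
  have TfE : T *m g *m f^T = delta_mx 0 0.
    by rewrite -Tf -!row_mul fgf rowE mulmx1.
  rewrite /lorentz mulmxBr mulmxBl fgf -scalemxAr -scalemxAl; congr (_ - _ *: _).
  have <- : (T *m g *m f^T)^T *m (T *m g *m f^T) = delta_mx 0 0.
    by rewrite TfE trmx_delta mul_delta_mx.
  by rewrite [(_ *m f^T)^T]trmx_mul trmxK !mulmxA.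
have fN0 : \det f != 0.
  by rewrite -unitfE -unitmxE; have [] := mulmx1_unit (etrans (mulmxA _ _ _) fgf).
have [f_lt0|f_gt0|/eqP] := ltgtP (\det f) 0; last by rewrite (negPf fN0).
  exists (minkowski *m f); split; last by rewrite det_mulmx det_minkowski mulN1r oppr_gt0.
  rewrite trmx_mul !mulmxA -[_ *m f *m _]mulmxA -[_ *m f^T]mulmxA [f *m _ *m _]fmf.
  rewrite minkowskiE tr_diag_mx !mulmx_diag; congr diag_mx.
  by apply/rowP => i; rewrite !mxE; case: (i == 0); rewrite ?expr1 ?expr0; ring.
by exists f.
Qed.

Lemma starL_sqr (g : 'M[R]_4) (T : E) : g^T = g ->
  (forall v, v != 0 -> 0 < bform g v v) -> bform g T T = 1 ->
  forall xi, hodge (lorentz g T) (hodge (lorentz g T) xi) = - xi.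
Proof.
move=> gT g_gt0 T1; have [f [fmf f_gt0]] := lorentz_frame gT g_gt0 T1.
have mT : (lorentz g T)^T = lorentz g T.
  by rewrite /lorentz linearB linearZ /= trmx_mul trmxK gT.
apply: (hodge_sqr mT (minkowski_frame fmf f_gt0)).
have := congr1 determinant fmf; rewrite !det_mulmx det_tr det_minkowski.
by rewrite mulrAC -expr2 => H; rewrite -(pmulr_rlt0 _ (exprn_gt0 2 f_gt0)) H oppr_lt0.
Qed.

End Frames.

(** * Normal forms of complex 3 x 3 matrices *)

Section Jordan.
Context {R : realType}.
Local Notation C := R[i].
Implicit Types (B P L : 'M[C]_3).

Lemma mx3E B : B = mx3 [:: [:: B 0 0; B 0 1; B 0 2]; [:: B 1 0; B 1 1; B 1 2];
                           [:: B 2 0; B 2 1; B 2 2]].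
Proof.
apply/matrixP => i j; rewrite mxE.
by case: i => -[|[|[|//]]] Hi; case: j => -[|[|[|//]]] Hj /=;
  congr (B _ _); apply: val_inj.
Qed.

Lemma tr_mx3 (a b c d e f g h k : C) :
  (mx3 [:: [:: a; b; c]; [:: d; e; f]; [:: g; h; k]])^T =
  mx3 [:: [:: a; d; g]; [:: b; e; h]; [:: c; f; k]].
Proof.
apply/matrixP => i j; rewrite !mxE.
by case: i => -[|[|[|//]]] Hi; case: j => -[|[|[|//]]] Hj.
Qed.

Lemma mulmx3 (a b c d e f g h k a' b' c' d' e' f' g' h' k' : C) :
  mx3 [:: [:: a; b; c]; [:: d; e; f]; [:: g; h; k]] *m
  mx3 [:: [:: a'; b'; c']; [:: d'; e'; f']; [:: g'; h'; k']] =
  mx3 [:: [:: a * a' + b * d' + c * g'; a * b' + b * e' + c * h'; a * c' + b * f' + c * k'];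
          [:: d * a' + e * d' + f * g'; d * b' + e * e' + f * h'; d * c' + e * f' + f * k'];
          [:: g * a' + h * d' + k * g'; g * b' + h * e' + k * h'; g * c' + h * f' + k * k']].
Proof.
apply/matrixP => i j; rewrite !mxE !big_ord_recl big_ord0 !mxE addr0 addrA.
by case: i => -[|[|[|//]]] Hi; case: j => -[|[|[|//]]] Hj.
Qed.

Definition eigenrows n (B : 'M[C]_n) k :=
  exists (X : 'M[C]_(k, n)) (d : 'rV[C]_k), row_free X /\ X *m B = diag_mx d *m X.

Definition mxsimilar n (B A : 'M[C]_n) := exists2 P, P \in unitmx & P *m B = A *m P.

Lemma mxsimilar_trans B1 B2 B3 :
  mxsimilar B1 B2 -> mxsimilar B2 B3 -> mxsimilar B1 B3.
Proof.
move=> [P uP PB] [Q uQ QB]; exists (Q *m P); first by rewrite unitmx_mul uQ.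
by rewrite -mulmxA PB !mulmxA QB.
Qed.

Lemma eigenrows_similar B1 B2 k :
  mxsimilar B1 B2 -> eigenrows B2 k -> eigenrows B1 k.
Proof.
move=> [P uP PB] [X [d [fX XB]]]; exists (X *m P), d; split.
  by rewrite /row_free mxrankMfree ?row_free_unit.
by rewrite -mulmxA PB !mulmxA XB.
Qed.

Lemma eigenrows1 B : eigenrows B 1.
Proof.
have [a] := eigenvalue_closed B (isT : (0 < 3)%N).
move=> /eigenvalueP [v vB vN0]; exists v, (const_mx a).
by split; rewrite ?/row_free ?rank_rV ?vN0 // vB diag_const_mx mul_scalar_mx.
Qed.

Lemma eigenrows_leq B k : eigenrows B k -> (k <= 3)%N.
Proof. by move=> [X [d [/eqP rX _]]]; rewrite -rX rank_leq_col. Qed.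

Lemma eigenrows3 B : eigenrows B 3 ->
  exists l1 l2 l3, mxsimilar B (formI l1 l2 l3)^T.
Proof.
move=> [X [d [fX XB]]]; exists (d 0 0), (d 0 1), (d 0 2).
exists X; first by rewrite -row_free_unit.
rewrite XB; congr (_ *m _); rewrite /formI tr_mx3.
by rewrite [LHS]mx3E !mxE /= ?mulr1n ?mulr0n.
Qed.

Lemma mx3_unit (a b c d e f g h k : C) :
  a * (e * k - f * h) - b * (d * k - f * g) + c * (d * h - e * g) != 0 ->
  mx3 [:: [:: a; b; c]; [:: d; e; f]; [:: g; h; k]] \in unitmx.
Proof. by rewrite unitmxE unitfE det3E !mxE. Qed.

Lemma block_mx3 (A : 'M[C]_2) (u : 'cV[C]_2) (v : 'rV[C]_2) (k : 'M[C]_1) :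
  block_mx A u v k =
  mx3 [:: [:: A 0 0; A 0 1; u 0 0]; [:: A 1 0; A 1 1; u 1 0]; [:: v 0 0; v 0 1; k 0 0]].
Proof.
apply/matrixP => i j.
case: (@split_ordP 2 1 i) => i' ->; case: (@split_ordP 2 1 j) => j' ->;
  rewrite ?(block_mxEul, block_mxEur, block_mxEdl, block_mxEdr) mxE /= ?ord1 //.
- by case: i' => -[|[|//]] Hi; case: j' => -[|[|//]] Hj /=; congr (A _ _); apply: val_inj.
- by case: i' => -[|[|//]] Hi /=; congr (u _ _); apply: val_inj.
- by case: j' => -[|[|//]] Hj /=; congr (v _ _); apply: val_inj.
Qed.

(** Two independent eigenvectors, completed to a basis by an arbitrary w. *)
Lemma eigenrows2_arrow B : eigenrows B 2 ->
  exists a b x y c, mxsimilar B (mx3 [:: [:: a; 0; 0]; [:: 0; b; 0]; [:: x; y; c]]).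
Proof.
move=> [X [d [fX XB]]].
have [w wX] : exists w : 'rV_3, ~~ (w <= X)%MS.
  apply: contrapT => /forallNP Xfull.
  have /mxrankS : (1%:M <= X)%MS by apply/row_subP => i; apply/negPn/negP/Xfull.
  by rewrite mxrank1 => /leq_trans/(_ (rank_leq_row X)).
pose P : 'M[C]_(2 + 1) := col_mx X w.
have uP : P \in unitmx.
  rewrite -row_free_unit -row_leq_rank /P -addsmxE.
  have /rank_ltmx : (X < X + w)%MS.
    rewrite ltmxE addsmxSl /=; apply: contra wX.
    exact/submx_trans/addsmxSr.
  by rewrite (eqP fX).
pose q : 'rV[C]_(2 + 1) := w *m B *m invmx P.
exists (d 0 0), (d 0 1), (lsubmx q 0 0), (lsubmx q 0 1), (rsubmx q 0 0).
exists P => //.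
transitivity (col_mx (row_mx (diag_mx d) 0) (row_mx (lsubmx q) (rsubmx q)) *m P).
  rewrite mul_col_mx hsubmxK mulmxKV // /P mul_row_col mul0mx addr0 -XB.
  exact: (@mul_col_mx _ 2 1 3 3 X w B).
by congr (_ *m _); rewrite -/(block_mx _ _ _ _) block_mx3 !mxE /= ?mulr1n ?mulr0n.
Qed.

(** The third basis vector w has image x u + y v + c w. Replacing w by s u + t v + w
changes x and y to x' and y', and the chosen s and t make x' vanish unless c = a,
and y' vanish unless c = b. So x' u + y' v always has eigenvalue c, and it is
nonzero as there is no third independent eigenvector: the pair x' u + y' v and
s u + t v + w spans a Jordan block. *)
Lemma eigenrows2_formII B : eigenrows B 2 -> ~ eigenrows B 3 ->
  exists l1 l2, mxsimilar B (formII l1 l2)^T.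
Proof.
move=> /eigenrows2_arrow[a [b [x [y [c BL]]]]] n3.
(* When a denominator is zero the quotient is 0: no correction is attempted. *)
pose s := x / (c - a); pose t := y / (c - b).
pose x' := x + s * (a - c); pose y' := y + t * (b - c).
have x'0 : x' * (a - c) = 0.
  rewrite /x' /s; have [->|ca] := eqVneq c a; first by rewrite subrr mulr0.
  by field; rewrite subr_eq0.
have y'0 : y' * (b - c) = 0.
  rewrite /y' /t; have [->|cb] := eqVneq c b; first by rewrite subrr mulr0.
  by field; rewrite subr_eq0.
have xE : x = x' - s * (a - c) by rewrite /x' addrK.
have yE : y = y' - t * (b - c) by rewrite /y' addrK.
have [y'E|y'N0] := eqVneq y' 0; last first.
  have bc : b = c.
    by apply/eqP; move/eqP: y'0; rewrite mulf_eq0 (negPf y'N0) subr_eq0.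
  exists a, b; apply: (mxsimilar_trans BL).
  exists (mx3 [:: [:: 1; 0; 0]; [:: x'; y'; 0]; [:: s; t; 1]]).
    by apply: mx3_unit; rewrite !(mulr0, mul0r, mulr1, mul1r, subr0, addr0).
  have xac : x' * a = x' * c by apply/eqP; rewrite -subr_eq0 -mulrBr x'0.
  rewrite /formII tr_mx3 !mulmx3; congr (mx3 [:: [:: _; _; _]; [:: _; _; _]; [:: _; _; _]]);
    rewrite ?xE ?yE ?bc ?xac; ring.
have [x'E|x'N0] := eqVneq x' 0.
  case: n3; apply: (eigenrows_similar BL).
  exists (mx3 [:: [:: 1; 0; 0]; [:: 0; 1; 0]; [:: s; t; 1]]).
  exists (\row_j nth 0 [:: a; b; c] j); split.
    by rewrite row_free_unit mx3_unit // !(mulr0,mul0r,mulr1,subr0,addr0) oner_neq0.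
  rewrite [diag_mx _]mx3E !mxE !mulmx3 /= !mulr0n !mulr1n.
  congr (mx3 [:: [:: _; _; _]; [:: _; _; _]; [:: _; _; _]]);
    rewrite ?xE ?yE ?x'E ?y'E; ring.
have ac : a = c.
  by apply/eqP; move/eqP: x'0; rewrite mulf_eq0 (negPf x'N0) subr_eq0.
exists b, a; apply: (mxsimilar_trans BL).
exists (mx3 [:: [:: 0; 1; 0]; [:: x'; y'; 0]; [:: s; t; 1]]).
  apply: mx3_unit.
  by rewrite !(mulr0, mul0r, mulr1, mul1r, subr0, addr0, sub0r) oppr_eq0.
rewrite /formII tr_mx3 !mulmx3; congr (mx3 [:: [:: _; _; _]; [:: _; _; _]; [:: _; _; _]]);
    rewrite ?xE ?yE ?y'E ?ac; ring.
Qed.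

Lemma triangular_form B : exists a b c x y z,
  mxsimilar B (mx3 [:: [:: a; 0; 0]; [:: x; b; 0]; [:: z; y; c]]).
Proof.
have [P /unitarymx_unit uP] := Schur B (isT : (0 < 3)%N).
rewrite /similar_to => /is_trig_mxP; rewrite conjumx //; set L := _ *m _ => L0.
exists (L 0 0), (L 1 1), (L 2 2), (L 1 0), (L 2 1), (L 2 0), P => //.
by rewrite -[LHS](mulmxKV uP) -/L {1}[L]mx3E !(L0 0 1, L0 0 2, L0 1 2).
Qed.

(** Let u, v, w be a triangular basis, with v sent to x u + b v and w to
z u + y v + c w. An eigenvector independent of u would result from b <> a, from
x = 0, from c <> a, or from y = 0; hence x and y are nonzero, and x y u, z u + y v,
w is a Jordan chain. *)
Lemma not_eigenrows2_formIII B : ~ eigenrows B 2 -> exists l, mxsimilar B (formIII l)^T.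
Proof.
have [a [b [c [x [y [z BL]]]]]] := triangular_form B => n2.
(* (r, t, u) is an eigenvector independent of the first basis vector. *)
have no_eigen (r t u e : C) : (t != 0) || (u != 0) ->
  r * a + t * x + u * z = e * r -> t * b + u * y = e * t -> u * c = e * u -> False.
  move=> tu0 E0 E1 E2; apply: n2; apply: (eigenrows_similar BL).
  exists (\matrix_(i, j) nth 0 (nth [::] [:: [:: 1; 0; 0]; [:: r; t; u]] i) j).
  exists (\row_j nth 0 [:: a; e] j); split; last first.
    apply/matrixP => i j; rewrite !mxE !big_ord_recl !big_ord0 !mxE /=.
    by case: i => -[|[|//]] Hi; case: j => -[|[|[|//]]] Hj /=;
      rewrite ?(mulr0n, mulr1n, mul0r, mulr0, mul1r, mulr1, addr0, add0r) -?E0 -?E1 -?E2 ?addrA.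
  rewrite -kermx_eq0; apply/rowV0P => v /sub_kermxP vX.
  have vXE k := congr1 (fun w : 'rV[C]_3 => w 0 k) vX.
  have := vXE 2; have := vXE 1; have := vXE 0.
  rewrite !mxE !big_ord_recl !big_ord0 !mxE /= !(mulr0, mulr1, addr0, add0r).
  have -> : lift ord0 ord0 = 1 :> 'I_2 by apply: val_inj.
  move=> v0E v1t v1u.
  have v1 : v 0 1 = 0.
    by case/orP: tu0 => N0; apply: (mulIf N0); rewrite mul0r.
  rewrite v1 mul0r addr0 in v0E.
  apply/rowP => i; rewrite mxE -[RHS]v1.
  by case: i => -[|[|//]] Hi; [rewrite v1 -[RHS]v0E|]; congr (v _ _); apply: val_inj.
have ab : a = b.
  apply/eqP/negPn/negP => ab; apply: (@no_eigen (x / (b - a)) 1 0 b).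
  - by rewrite oner_neq0.
  - by field; rewrite subr_eq0 eq_sym.
  - ring.
  - ring.
rewrite -{b}ab in BL no_eigen *.
have xN0 : x != 0.
  apply/eqP => x0; apply: (@no_eigen 0 1 0 a); rewrite ?oner_neq0 // ?x0; ring.
have ac : a = c.
  apply/eqP/negPn/negP => ac; pose t := y / (c - a).
  have ca0 : c - a != 0 by rewrite subr_eq0 eq_sym.
  apply: (@no_eigen ((z + t * x) / (c - a)) t 1 c).
  - by rewrite oner_neq0 orbT.
  - by rewrite /t; field.
  - by rewrite /t; field.
  - ring.
rewrite -{c}ac in BL no_eigen *.
have yN0 : y != 0.
  apply/eqP => y0; apply: (@no_eigen 0 (- z / x) 1 a).
  - by rewrite oner_neq0 orbT.
  - by field.
  - by rewrite y0; ring.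
  - ring.
exists a; apply: (mxsimilar_trans BL).
exists (mx3 [:: [:: x * y; 0; 0]; [:: z; y; 0]; [:: 0; 0; 1]]).
  by apply: mx3_unit; rewrite !(mulr0, mul0r, mulr1, mul1r, subr0, addr0, sub0r) !mulf_neq0.
rewrite /formIII tr_mx3 !mulmx3; congr (mx3 [:: [:: _; _; _]; [:: _; _; _]; [:: _; _; _]]);
    ring.
Qed.
End Jordan.

(** * Vector spaces with a complex structure *)

Section ComplexBases.
Context {R : realType} {V : vectType R} (J : 'End(V)).
Hypothesis JJ : forall v, J (J v) = - v.
Local Notation C := R[i].
(* The name also denotes an operation on charges. *)
Local Notation cscale := Defs.cscale.
Local Notation "z *c v" := (cscale J z v) (at level 40).
Implicit Types (z w : C) (v : V) (S : 'End(V)).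

Lemma cscaleDl z w v : (z + w) *c v = z *c v + w *c v.
Proof. by case: z w => [a b] [c d]; rewrite /cscale /= !scalerDl addrACA. Qed.

Lemma cscaleDr z u v : z *c (u + v) = z *c u + z *c v.
Proof. by rewrite /cscale [J (u + v)]linearD /= !scalerDr addrACA. Qed.

Lemma cscaler0 z : z *c 0 = 0.
Proof. by rewrite /cscale [J 0]linear0 !scaler0 addr0. Qed.

Lemma cscale0l v : 0 *c v = 0.
Proof. by rewrite /cscale /= !scale0r addr0. Qed.

Lemma cscale1l v : 1 *c v = v.
Proof. by rewrite /cscale /= scale1r scale0r addr0. Qed.

Lemma cscaleA z w v : z *c (w *c v) = (z * w) *c v.
Proof.
case: z w => [a b] [c d]; rewrite /cscale /= [J (_ + _)]linearD /= ![J (_ *: _)]linearZ /= JJ.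
rewrite !scalerDr !scalerN !scalerA scalerBl scalerDl.
by rewrite [RHS]addrACA [- _ + _]addrC.
Qed.

Lemma cscale_sumr z (I : finType) (f : I -> V) :
  z *c (\sum_i f i) = \sum_i z *c f i.
Proof.
by apply: (big_morph (cscale J z) (id1 := 0) (op1 := +%R)) => [u v|];
  rewrite ?cscaleDr ?cscaler0.
Qed.

Definition ccomb k (xi : 'I_k -> V) (c : 'rV[C]_k) : V :=
  \sum_i c 0 i *c xi i.

Section Comb.
Variables (k : nat) (xi : 'I_k -> V).

Lemma ccombZ z c : ccomb xi (z *: c) = z *c ccomb xi c.
Proof.
by rewrite cscale_sumr; apply: eq_bigr => i _; rewrite mxE cscaleA.
Qed.

Lemma ccombD c d : ccomb xi (c + d) = ccomb xi c + ccomb xi d.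
Proof.
by rewrite -big_split; apply: eq_bigr => i _; rewrite mxE cscaleDl.
Qed.

Lemma ccomb0 : ccomb xi 0 = 0.
Proof. by apply: big1 => i _; rewrite mxE cscale0l. Qed.

Lemma ccombN c : ccomb xi (- c) = - ccomb xi c.
Proof. by apply/eqP; rewrite -addr_eq0 -ccombD addNr ccomb0. Qed.

Lemma ccomb_sum (I : finType) (f : I -> 'rV[C]_k) :
  ccomb xi (\sum_i f i) = \sum_i ccomb xi (f i).
Proof. by apply: (big_morph _ ccombD ccomb0). Qed.

Lemma ccomb_comb l (X : 'M[C]_(l, k)) c :
  ccomb (fun j => ccomb xi (row j X)) c = ccomb xi (c *m X).
Proof.
rewrite mulmx_sum_row ccomb_sum; apply: eq_bigr => j _.
by rewrite ccombZ.
Qed.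

Lemma clin_indepP : clin_indep J xi <-> forall c, ccomb xi c = 0 -> c = 0.
Proof.
split=> [xiP c c0|xiP c c0 i].
  by apply/rowP => i; rewrite mxE; apply: (xiP (fun i => c 0 i)).
have /(xiP _) /rowP/(_ i) : ccomb xi (\row_j c j) = 0.
  by rewrite -[RHS]c0; apply: eq_bigr => j _; rewrite mxE.
by rewrite !mxE.
Qed.

Lemma cspanningP : cspanning J xi <-> forall v, exists c, v = ccomb xi c.
Proof.
split=> xiP v; have [c ->] := xiP v; last by exists (fun i => c 0 i).
by exists (\row_j c j); apply: eq_bigr => j _; rewrite mxE.
Qed.

(** The same combinations with real and imaginary parts in separate columns:
real-linear on a space of known real dimension, so that dimensions can be counted
with real subspaces. *)
Definition rcomb (A : 'M[R]_(k, 2)) : V :=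
  \sum_i (A i 0 *: xi i + A i 1 *: J (xi i)).

Lemma rcomb_is_linear : linear rcomb.
Proof.
move=> a A B; rewrite /rcomb scaler_sumr -big_split /=.
by apply: eq_bigr => i _; rewrite !mxE !scalerDl !scalerDr !scalerA addrACA.
Qed.
HB.instance Definition _ := GRing.isLinear.Build R _ _ _ rcomb rcomb_is_linear.

Lemma ccomb_rcomb c :
  ccomb xi c = rcomb (\matrix_(i, j) if j == 0 then complex.Re (c 0 i) else complex.Im (c 0 i)).
Proof. by apply: eq_bigr => i _; rewrite !mxE. Qed.

Lemma rcomb_ccomb A : rcomb A = ccomb xi (\row_i (A i 0 +i* A i 1)%C).
Proof. by apply: eq_bigr => i _; rewrite !mxE. Qed.

Lemma dim_rcomb : clin_indep J xi -> \dim (limg (linfun rcomb)) = (k * 2)%N.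
Proof.
move=> /clin_indepP xiP; rewrite limg_dim_eq.
  by rewrite dimvf dim_matrix.
apply/eqP; rewrite capfv; apply/eqP/vspaceP => A.
rewrite memv_ker memv0 lfunE /= rcomb_ccomb.
apply/eqP/eqP => [/xiP c0|->].
  apply/matrixP => i j; have /rowP/(_ i) := c0; rewrite !mxE => -[A0 A1].
  by case: j => -[|[|//]] Hj; [rewrite -[RHS]A0|rewrite -[RHS]A1];
    congr (A _ _); apply: val_inj.
by rewrite -rcomb_ccomb linear0.
Qed.
End Comb.

(** The complex span of k independent vectors has real dimension 2k, hence misses
some v. If v entered a complex relation, dividing by its coefficient would put v
in the span. *)
Lemma clin_indep_extend k (xi : 'I_k -> V) : clin_indep J xi ->
  (k * 2 < \dim {:V})%N -> exists xi' : 'I_k.+1 -> V, clin_indep J xi'.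
Proof.
move=> xiP lt_k.
have [v vP] : exists v, forall c, v <> ccomb xi c.
  apply: contrapT => /forallNP span.
  move: lt_k; rewrite -(dim_rcomb xiP) ltnNge => /negP; apply.
  apply/dimvS/subvP => v _.
  have /existsNP[c /contrapT ->] := span v.
  by rewrite ccomb_rcomb -[rcomb _ _]lfunE memv_img ?memvf.
exists (fun i => if unlift ord0 i is Some j then xi j else v).
apply/clin_indepP => c; rewrite /ccomb big_ord_recl unlift_none.
pose c' := \row_j c 0 (lift ord0 j).
rewrite (eq_bigr (fun i => c' 0 i *c xi i)); last by move=> i _; rewrite liftK mxE.
rewrite -/(ccomb xi c') => c0.
have c00 : c 0 ord0 = 0.
  apply/eqP/negPn/negP => cN0; apply: (vP (- (c 0 ord0)^-1 *: c')).
  have := congr1 (cscale J (c 0 ord0)^-1) c0.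
  rewrite cscaler0 cscaleDr cscaleA mulVf // cscale1l -ccombZ => /eqP.
  by rewrite addr_eq0 => /eqP ->; rewrite scaleNr ccombN.
move: c0; rewrite c00 cscale0l add0r => c'0.
move/clin_indepP: xiP => /(_ _ c'0) /rowP c'E.
apply/rowP => i; rewrite mxE.
case: (unliftP ord0 i) => [j ->|-> //].
by have := c'E j; rewrite !mxE.
Qed.

Lemma complex_basis n : \dim {:V} = (n * 2)%N ->
  exists xi : 'I_n -> V, clin_indep J xi /\ cspanning J xi.
Proof.
move=> dimV.
have [xi xiP] : exists xi : 'I_n -> V, clin_indep J xi.
  suff: forall k, (k <= n)%N -> exists xi : 'I_k -> V, clin_indep J xi by apply.
  elim=> [_|k IHk lt_kn]; first by exists (fun=> 0) => c _ [].
  have [xi xiP] := IHk (ltnW lt_kn).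
  by apply: (clin_indep_extend xiP); rewrite dimV ltn_mul2r.
exists xi; split=> //; apply/cspanningP => v.
have /eqP limgV : limg (linfun (rcomb xi)) == fullv.
  by rewrite eqEdim subvf dimV dim_rcomb /=.
have /memv_imgP[A _ ->] : v \in limg (linfun (rcomb xi)) by rewrite limgV memvf.
by rewrite lfunE /= rcomb_ccomb; eexists.
Qed.

Section Matrix.
Variables (n : nat) (xi : 'I_n -> V) (S : 'End(V)).
Hypotheses (xi_indep : clin_indep J xi) (xi_span : cspanning J xi).
Hypothesis SJ : forall v, S (J v) = J (S v).

Lemma cscale_endo z v : S (z *c v) = z *c S v.
Proof. by rewrite /cscale [S (_ + _)]linearD /= ![S (_ *: _)]linearZ /= SJ. Qed.

Lemma ccomb_inj : injective (ccomb xi).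
Proof.
move=> c d cd; apply/eqP; rewrite -subr_eq0; apply/eqP.
by move/clin_indepP: xi_indep; apply; rewrite ccombD ccombN cd subrr.
Qed.

Lemma family_coords k (eta : 'I_k -> V) :
  exists X : 'M[C]_(k, n), forall i, eta i = ccomb xi (row i X).
Proof.
move/cspanningP: xi_span => span.
have [c cP] := choice (fun i => span (eta i)).
by exists (\matrix_i c i) => i; rewrite rowK.
Qed.

(** Commuting with J is what makes S complex-linear, hence given by a complex
matrix; coordinates are rows, so the matrix acts on the right. *)
Lemma endo_mx : exists B : 'M[C]_n, forall c, S (ccomb xi c) = ccomb xi (c *m B).
Proof.
have [B BP] := family_coords (S \o xi); exists B => c.
rewrite -ccomb_comb linear_sum /=; apply: eq_bigr => i _.
by rewrite cscale_endo -BP.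
Qed.

Variable B : 'M[C]_n.
Hypothesis SB : forall c, S (ccomb xi c) = ccomb xi (c *m B).

Lemma clin_indep_row_free k (X : 'M[C]_(k, n)) :
  clin_indep J (fun i => ccomb xi (row i X)) <-> row_free X.
Proof.
rewrite clin_indepP -kermx_eq0; split=> [XP|/rowV0P XP c].
  apply/rowV0P => c /sub_kermxP cX; apply: XP.
  by rewrite ccomb_comb cX ccomb0.
rewrite ccomb_comb -(ccomb0 xi) => /ccomb_inj cX.
exact/XP/sub_kermxP.
Qed.

(** The transpose appears because [csimilar] reads the image of a basis vector off
a column, while coordinates are rows here. *)
Lemma row_similar_csimilar (A P : 'M[C]_n) : P \in unitmx -> P *m B = A^T *m P ->
  csimilar J S A.
Proof.
move=> uP PB; exists (fun i => ccomb xi (row i P)); split.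
- by apply/clin_indep_row_free; rewrite row_free_unit.
- apply/cspanningP => v; move/cspanningP: xi_span => /(_ v)[c ->].
  by exists (c *m invmx P); rewrite ccomb_comb mulmxKV.
- move=> j; rewrite SB -row_mul PB row_mul -ccomb_comb.
  by apply: eq_bigr => i _; rewrite !mxE.
Qed.

End Matrix.

Lemma eigenvectorsP n (xi : 'I_n -> V) S (B : 'M[C]_n) k :
  clin_indep J xi -> cspanning J xi ->
  (forall c, S (ccomb xi c) = ccomb xi (c *m B)) ->
  has_indep_eigenvectors J S k <-> eigenrows B k.
Proof.
move=> xi_indep xi_span SB; split=> [[eta [eta_indep eta_eigen]]|[X [d [fX XB]]]].
  have [X etaX] := family_coords xi_span eta.
  have [d dP] := choice eta_eigen.
  exists X, (\row_i d i); split.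
    apply/(clin_indep_row_free xi_indep).
    by have <- : eta = fun i => ccomb xi (row i X) by apply/funext.
  apply/row_matrixP => i; rewrite row_mul row_mul row_diag_mx -scalemxAl -rowE mxE.
  by apply: (ccomb_inj xi_indep); rewrite -SB ccombZ -etaX.
exists (fun i => ccomb xi (row i X)); split.
  exact/(clin_indep_row_free xi_indep).
by move=> i; exists (d 0 i); rewrite SB -row_mul XB row_mul row_diag_mx -scalemxAl -rowE ccombZ.
Qed.

(** The forms are read off from lower bounds on the number of independent
eigenvectors and upper bounds below 3; the bound at 3 is the dimension. *)
Theorem complex_jordan3 S : \dim {:V} = 6%N -> (forall v, S (J v) = J (S v)) ->
  [/\ [\/ num_eigenvectors J S 3, num_eigenvectors J S 2 | num_eigenvectors J S 1],
      num_eigenvectors J S 3 -> exists l1 l2 l3, csimilar J S (formI l1 l2 l3),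
      num_eigenvectors J S 2 -> exists l1 l2, csimilar J S (formII l1 l2)
    & num_eigenvectors J S 1 -> exists l, csimilar J S (formIII l)].
Proof.
move=> dimV SJ; have [xi [xi_indep xi_span]] := complex_basis (dimV : _ = (3 * 2)%N).
have [B SB] := endo_mx xi_span SJ.
have eigP k := propext (eigenvectorsP k xi_indep xi_span SB).
have sim A : mxsimilar B A^T -> csimilar J S A.
  by move=> [P uP PB]; apply: (row_similar_csimilar xi_indep xi_span SB uP PB).
rewrite /num_eigenvectors !eigP; split.
- have n4 : ~ eigenrows B 4 by move=> /eigenrows_leq.
  have e1 := eigenrows1 B.
  have [e3|n3] := pselect (eigenrows B 3); first by constructor 1.
  by have [e2|n2] := pselect (eigenrows B 2); [constructor 2|constructor 3].
- by move=> [/eigenrows3[l1 [l2 [l3 /sim BE]]] _]; exists l1, l2, l3.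
- move=> [e2 n3].
  by have [l1 [l2 /sim BE]] := eigenrows2_formII e2 n3; exists l1, l2.
- move=> [_ n2].
  by have [l /sim BE] := not_eigenrows2_formIII n2; exists l.
Qed.
End ComplexBases.

(** * The theorem *)

Theorem theorem3 (R : realType) (M : topologicalType)
  (A : oriented_manifold4 R M) (g : riemannian_metric A) (T : vector_field A)
  (T_unit : unit_length g T) (gT_einstein : starL_einstein g T)
  (p : M) (i : chart_index A) (p_in : dom i p) :
  [/\ [\/ petrovI g T i p, petrovII g T i p | petrovIII g T i p],
      petrovI g T i p -> exists l1 l2 l3 : R[i],
        csimilar (starL g T i p) (Rhat g i p) (formI l1 l2 l3),
      petrovII g T i p -> exists l1 l2 : R[i],
        csimilar (starL g T i p) (Rhat g i p) (formII l1 l2)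
    & petrovIII g T i p -> exists l1 : R[i],
        csimilar (starL g T i p) (Rhat g i p) (formIII l1)].
Proof.
have cod_p : cod i (phi i p) by exists p.
apply: complex_jordan3.
- by apply: starL_sqr; [exact: Defs.metric_sym|exact: metric_pos|exact: T_unit].
- exact: dim_Lambda2.
- move=> v; have := congr1 (fun f : 'End(Lambda2) => f v) (gT_einstein _ _ p_in).
  by rewrite !comp_lfunE.
Qed.
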